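(* Let $0<\varrho_\alpha<1$ be a function of $\alpha\in(0,1)$, write $\Delta(\alpha)=\Delta(\alpha,\varrho_\alpha)$, and let $T_\alpha=\inf\{n\ge1:\sum_{k=1}^n e^{Z^{k-1}_n}\ge h_\alpha\}$ with $h_\alpha=\frac{1-\alpha}{\varrho_\alpha\alpha}$. (i) Assume that for some $0<I<\infty$ $$\sum_{n=1}^\infty\sup_{k\ge0}\mathsf P_k\Big\{\Big|\frac1n Z^k_{k+n}-I\Big|>\varepsilon\Big\}<\infty\quad\text{for all }\varepsilon>0,$$ and that $\varrho_\alpha\to0$ and $|\log\varrho_\alpha|/|\log\alpha|\to0$ as $\alpha\to0$. Then $$\lim_{\alpha\to0}\frac{\inf_{\tau\in\Delta(\alpha)}\mathcal R_\nu(\tau)}{\mathcal R_\nu(T_\alpha)}=1\ \text{ for all }\nu\ge0,\qquad \lim_{\alpha\to0}\frac{\inf_{\tau\in\Delta(\alpha)}\sup_{\nu\ge0}\mathcal R_\nu(\tau)}{\sup_{\nu\ge0}\mathcal R_\nu(T_\alpha)}=1.$$ Moreover, as $\alpha\to0$, $$\inf_{\tau\in\Delta(\alpha)}\mathcal R_\nu(\tau)\sim\mathcal R_\nu(T_\alpha)\sim\frac{|\log\alpha|}{I}\ \text{ for all }\nu\ge0,\qquad \inf_{\tau\in\Delta(\alpha)}\sup_{\nu\ge0}\mathcal R_\nu(\tau)\sim\sup_{\nu\ge0}\mathcal R_\nu(T_\alpha)\sim\frac{|\log\alpha|}{I}.$$ (ii) Assume in addition that $k^*=k^*_\alpha$ is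 a function of $\alpha$ with $k^*_\alpha\to\infty$ and $|\log\alpha|+k^*_\alpha\log(1-\varrho_\alpha)\to+\infty$ as $\alpha\to0$. Then $$\lim_{\alpha\to0}\frac{\inf_{\tau\in\Delta(\alpha)}\mathcal R^*_\nu(\tau)}{\mathcal R^*_\nu(T_\alpha)}=1\ \text{ for all fixed }\nu\ge0,\qquad \lim_{\alpha\to0}\frac{\inf_{\tau\in\Delta(\alpha)}\max_{0\le\nu\le k^*_\alpha}\mathcal R^*_\nu(\tau)}{\max_{0\le\nu\le k^*_\alpha}\mathcal R^*_\nu(T_\alpha)}=1.$$ Moreover, as $\alpha\to0$, $$\inf_{\tau\in\Delta(\alpha)}\mathcal R^*_\nu(\tau)\sim\mathcal R^*_\nu(T_\alpha)\sim\frac{|\log\alpha|}{I}\ \text{ for all fixed }\nu\ge0,$$ $$\inf_{\tau\in\Delta(\alpha)}\max_{0\le\nu\le k^*_\alpha}\mathcal R^*_\nu(\tau)\sim\max_{0\le\nu\le k^*_\alpha}\mathcal R^*_\nu(T_\alpha)\sim\frac{|\log\alpha|}{I}.$$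
   Context: Model. $X_1,X_2,\dots$ are observed random variables, $\mathbf X^n=(X_1,\dots,X_n)$, $\mathcal F_n=\sigma(X_1,\dots,X_n)$. The change point is $\nu\in\{0,1,2,\dots\}\cup\{\infty\}$; $X_\nu$ is the last pre-change observation and $\nu=\infty$ means no change. $f_{0,n}(X_n|\mathbf X^{n-1})$ and $f_{1,n}(X_n|\mathbf X^{n-1})$, $n\ge1$, are the pre- and post-change conditional densities of $X_n$ given $\mathbf X^{n-1}$ with respect to a sigma-finite measure $\mu$ (for $n=1$, unconditional densities; $f_{1,n}$ may depend on the change point). Under $\mathsf P_\infty$ (expectation $\mathsf E_\infty$) the conditional density of $X_n$ given $\mathbf X^{n-1}$ is $f_{0,n}$ for all $n\ge1$; under $\mathsf P_k$ (expectation $\mathsf E_k$), $0\le k<\infty$, it is $f_{0,n}$ for $n\le k$ and $f_{1,n}$ for $n>k$. For $k\le n-1$ the log-likelihood ratio is $$Z^k_n=\sum_{j=k+1}^n\log\frac{f_{1,j}(X_j|\mathbf X^{j-1})}{f_{0,j}(X_j|\mathbf X^{j-1})},\qquad \frac{d\mathsf P_k|_{\mathcal F_n}}{d\mathsf P_\infty|_{\mathcal F_n}}=e^{Z^k_n}$$ (where $f_{1,j}$ is the post-change density corresponding to change point $k$). $\mathcal M$ is the set of stopping times $\tau$ with respect to $(\mathcal F_n)$ with values in $\{1,2,\dots\}\cup\{\infty\}$; $\inf\varnothing=+\infty$. Risks, for finite $\nu\ge0$: $\mathcal R_\nu(\tau)=\mathsf E_\nu(\tau-\nu)^+$ and $\mathcal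 R^*_\nu(\tau)=\mathsf E_\nu(\tau-\nu\mid\tau>\nu)$. With $\pi_k(\varrho)=\varrho(1-\varrho)^k$, $k\ge0$, and $0<\alpha,\varrho<1$, $$\Delta(\alpha,\varrho)=\Big\{\tau\in\mathcal M:\ \sum_{k\ge1}\pi_k(\varrho)\,\mathsf P_\infty(\tau\le k)\le\alpha\Big\}.$$ $a_\alpha\sim b_\alpha$ means $a_\alpha/b_\alpha\to1$. *)

(* Defs.v *)
From HB Require Import structures.
From mathcomp Require Import all_boot all_order all_algebra.
From mathcomp Require Import all_classical all_reals all_analysis.

Set Implicit Arguments.
Unset Strict Implicit.
Unset Printing Implicit Defensive.

Import Order.TTheory GRing.Theory Num.Theory.
Import numFieldNormedType.Exports.

Local Open Scope classical_set_scope.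
Local Open Scope ring_scope.
Local Open Scope ereal_scope.

(* Observations are X 1, X 2, ...; the value X 0 is never used. *)
Definition history (Omega E : Type) (X : nat -> Omega -> E) (n : nat)
    (w : Omega) : n.-tuple E :=
  [tuple X i.+1 w | i < n].

Definition natural_filtration (Omega : Type) (dE : measure_display)
    (E : measurableType dE) (X : nat -> Omega -> E) (n : nat)
    : set (set Omega) :=
  <<s \bigcup_(i in [set i | (1 <= i <= n)%N])
        preimage_set_system setT (X i) measurable >>.

(* Times are extended reals, so that the infinite time is +oo and the infimum
   of the empty set is ereal_inf set0 = +oo. *)
Definition stopping_time (R : realType) (Omega : Type)
    (F : nat -> set (set Omega)) (tau : Omega -> \bar R) : Prop :=
  (forall w, (exists2 n : nat, (1 <= n)%N & tau w = n%:R%:E) \/ tau w = +oo) /\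
  (forall n : nat, F n [set w | tau w <= n%:R%:E]).

(* f is a version of the conditional density of Y given H with respect to mu. *)
Definition conditional_density (R : realType)
    (dO dH dE : measure_display) (Omega : measurableType dO)
    (T : measurableType dH) (E : measurableType dE)
    (mu : {sigma_finite_measure set E -> \bar R}) (P : probability Omega R)
    (H : Omega -> T) (Y : Omega -> E) (f : T -> E -> R) : Prop :=
  [/\ measurable_fun setT (fun p : T * E => f p.1 p.2),
      (forall h y, 0 <= f h y)%R &
      forall (A : set T) (B : set E), measurable A -> measurable B ->
        P (H @^-1` A `&` Y @^-1` B) =
        \int[P]_(w in H @^-1` A) \int[mu]_(y in B) (f (H w) y)%:E].

(* f0 n and f1 k n are the densities of X n given X 1, ..., X (n - 1), before
   the change and after a change at k.  The conventions x / 0 = 0 and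
   lne 0 = -oo make this a total function with values in [-oo, +oo[; the event
   where a pre-change density vanishes is null under every law of a
   change_point_model. *)
Definition llr (R : realType) (Omega E : Type) (X : nat -> Omega -> E)
    (f0 : forall n : nat, n.-1.-tuple E -> E -> R)
    (f1 : nat -> forall n : nat, n.-1.-tuple E -> E -> R)
    (k n : nat) (w : Omega) : \bar R :=
  \sum_(k.+1 <= j < n.+1)
    lne (f1 k j (history X j.-1 w) (X j w) /
         f0 j (history X j.-1 w) (X j w))%R%:E.

(* Pinf is the law without change, P k the law with change point k (X k is the
   last pre-change observation).  The last field says that the restriction of
   P k to the sigma-algebra of the first n observations has density
   exp (llr k n) with respect to that of Pinf; in particular the former is
   absolutely continuous with respect to the latter. *)
Record change_point_model (R : realType) (dO dE : measure_display)
    (Omega : measurableType dO) (E : measurableType dE)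
    (mu : {sigma_finite_measure set E -> \bar R})
    (X : nat -> Omega -> E)
    (Pinf : probability Omega R) (P : nat -> probability Omega R)
    (f0 : forall n : nat, n.-1.-tuple E -> E -> R)
    (f1 : nat -> forall n : nat, n.-1.-tuple E -> E -> R)
    : Prop := ChangePointModel {
  observation_measurable :
    forall n, (1 <= n)%N -> measurable_fun setT (X n);
  no_change_density : forall n, (1 <= n)%N ->
    conditional_density mu Pinf (history X n.-1) (X n) (f0 n);
  pre_change_density : forall k n, (1 <= n <= k)%N ->
    conditional_density mu (P k) (history X n.-1) (X n) (f0 n);
  post_change_density : forall k n, (k < n)%N ->
    conditional_density mu (P k) (history X n.-1) (X n) (f1 k n);
  likelihood_ratio : forall k n, (k < n)%N ->
    forall A, natural_filtration X n A ->
      P k A = \int[Pinf]_(w in A) expeR (llr X f0 f1 k n w)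
}.

Definition risk (R : realType) (dO : measure_display)
    (Omega : measurableType dO) (P : nat -> probability Omega R)
    (nu : nat) (tau : Omega -> \bar R) : \bar R :=
  \int[P nu]_w maxe (tau w - nu%:R%:E) 0.

(* Conditional expectation given an event; equal to 0 on a null event. *)
Definition conditional_risk (R : realType) (dO : measure_display)
    (Omega : measurableType dO) (P : nat -> probability Omega R)
    (nu : nat) (tau : Omega -> \bar R) : \bar R :=
  (\int[P nu]_(w in [set w | nu%:R%:E < tau w]) (tau w - nu%:R%:E)) /
  P nu [set w | nu%:R%:E < tau w].

Definition geometric_prior (R : realType) (rho : R) (k : nat) : R :=
  (rho * (1 - rho) ^+ k)%R.

Definition Delta (R : realType) (dO dE : measure_display)
    (Omega : measurableType dO) (E : measurableType dE)
    (X : nat -> Omega -> E) (Pinf : probability Omega R) (alpha rho : R)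
    : set (Omega -> \bar R) :=
  [set tau | stopping_time (natural_filtration X) tau /\
     \sum_(1 <= k <oo)
        (geometric_prior rho k)%:E * Pinf [set w | tau w <= k%:R%:E]
       <= alpha%:E].

Definition sr_statistic (R : realType) (Omega E : Type) (X : nat -> Omega -> E)
    (f0 : forall n : nat, n.-1.-tuple E -> E -> R)
    (f1 : nat -> forall n : nat, n.-1.-tuple E -> E -> R)
    (n : nat) (w : Omega) : \bar R :=
  \sum_(1 <= k < n.+1) expeR (llr X f0 f1 k.-1 n w).

Definition sr_threshold (R : realType) (alpha rho : R) : R :=
  ((1 - alpha) / (rho * alpha))%R.

Definition sr_time (R : realType) (Omega E : Type) (X : nat -> Omega -> E)
    (f0 : forall n : nat, n.-1.-tuple E -> E -> R)
    (f1 : nat -> forall n : nat, n.-1.-tuple E -> E -> R)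
    (h : R) (w : Omega) : \bar R :=
  ereal_inf [set n%:R%:E | n in
    [set n : nat | (1 <= n)%N /\ h%:E <= sr_statistic X f0 f1 n w]].

Definition uniform_complete_convergence (R : realType) (dO : measure_display)
    (Omega : measurableType dO) (E : Type) (X : nat -> Omega -> E)
    (P : nat -> probability Omega R)
    (f0 : forall n : nat, n.-1.-tuple E -> E -> R)
    (f1 : nat -> forall n : nat, n.-1.-tuple E -> E -> R)
    (I : R) : Prop :=
  forall eps : R, (0 < eps)%R ->
    \sum_(1 <= n <oo)
      ereal_sup (range (fun k : nat =>
        P k [set w | eps%:E <
               `| (n%:R^-1)%R%:E * llr X f0 f1 k (k + n)%N w - I%:E |]))
    < +oo.

(* The quotient is taken in \bar R, where x / 0 is 0 or infinite and
   x / +oo = 0; so convergence to 1 forces a and b to be eventually finite and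
   nonzero. *)
Definition asymp_equiv (R : realType) (a b : R -> \bar R) : Prop :=
  a x / b x @[x --> (0:R)%R^'+] --> 1.

(* Main.v *)
Require Import Defs.
From HB Require Import structures.
From mathcomp Require Import all_boot all_order all_algebra.
From mathcomp Require Import all_classical all_reals all_analysis.
From mathcomp Require Import measurable_realfun.
From mathcomp Require Import ring lra.

Set Implicit Arguments.
Unset Strict Implicit.
Unset Printing Implicit Defensive.

Import Order.TTheory GRing.Theory Num.Theory.
Import numFieldNormedType.Exports.

Local Open Scope classical_set_scope.
Local Open Scope ring_scope.
Local Open Scope ereal_scope.
(** Every risk in the statement is squeezed, up to a factor [1 + o(1)], to
    [|log alpha| / I]: from below for all the tests in [Delta] at once, from
    above for the Shiryaev-Roberts time [T].

    Lower bound ([risk_asymp_lower]).  Let [tau] be in [Delta] and let [n] be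
    close to [(1 - e) |log alpha| / I].  By Markov's inequality it is enough to
    show that [P nu (tau <= nu + n)] tends to 0.  Changing the measure on the
    first [nu + n] observations bounds it by
    [P nu (Z > c) + exp c * Pinf (tau <= nu + n)], where [Z] is the
    log-likelihood ratio of the [n] observations that follow the change
    ([change_of_measure]).  With [c = (1 + e) I n] the first term is a
    deviation probability of the complete convergence assumption.  In the
    second, [exp c] is at most [alpha ^ (e ^ 2 - 1)], whereas the constraint
    defining [Delta] gives
    [Pinf (tau <= m) <= alpha / (1 - rho) ^ m] ([Delta_false_alarm]); as rho
    tends to 0 the product behaves like a positive power of alpha.  The two
    laws are compared at the single time [nu + n], by which the event
    [tau <= nu + n] is decided.

    Upper bound ([risk_asymp_upper]).  The statistic dominates each of its
    summands, so [T > nu + m] forces [Z] over the first [m] post-change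
    observations to stay below [log h].  If [m] exceeds
    [log h / (I - eps)], this is again a deviation event.  Summing the tail
    probabilities, the risk is at most [log h / (I - eps)] plus a convergent
    series that does not depend on [nu].  Finally [log h] is equivalent to
    [|log alpha|], by the assumption on [log rho].

    [T] is in [Delta] as soon as [alpha <= rho] ([sr_time_Delta]): the process
    [SR n - n] is a [Pinf]-martingale, whence [Pinf (T <= k) <= k / h]
    ([false_alarm_bound]), and the mean of the geometric prior turns this into
    the bound alpha.

    Conditional risks.  Before the change [P nu] and [Pinf] have the same
    conditional densities, hence agree on the first [nu] observations
    ([pre_change_law]).  So the conditional risk is the risk divided by
    [1 - Pinf (tau <= nu)], and this divisor tends to 1 uniformly over
    [nu <= kstar], because [alpha / (1 - rho) ^ kstar] tends to 0
    ([near_early_stopping]). *)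

(** * Measurability of the likelihood ratios *)

Section measurable_exp_log.
Context d (T : measurableType d) (R : realType).

Lemma measurable_expeR_comp (f : T -> \bar R) :
  measurable_fun setT f -> measurable_fun setT (fun x => expeR (f x)).
Proof.
move=> mf; apply: (measurability _ (ErealGenOInfty.measurableE R)).
move=> _ [_ [r ->] <-]; rewrite setTI.
have [r0|r0] := ltP r 0%R.
  rewrite (_ : _ @^-1` _ = setT); first exact: measurableT.
  apply/seteqP; split => // x _ /=; rewrite in_itv/= andbT.
  by rewrite (lt_le_trans _ (expeR_ge0 _)).
rewrite (_ : _ @^-1` _ = setT `&` [set x | lne r%:E < f x]).
  exact: emeasurable_fun_o_infty.
have lneE x : (lne r%:E < f x) = (r%:E < expeR (f x)).
  by rewrite -lte_expeR lneK // in_itv/= lee_fin r0 leey.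
rewrite setTI; apply/funext => x; rewrite -[RHS]/(is_true (lne r%:E < f x)).
by rewrite lneE /= in_itv/= andbT.
Qed.

Lemma measurable_lne_comp (f : T -> R) :
  measurable_fun setT f -> measurable_fun setT (fun x => lne (f x)%:E).
Proof.
move=> mf; apply: (measurability _ (ErealGenOInfty.measurableE R)).
move=> _ [_ [r ->] <-]; rewrite setTI.
rewrite (_ : _ @^-1` _ = setT `&` [set x | (expR r)%:E < (f x)%:E]).
  by apply: emeasurable_fun_o_infty => //; exact/measurable_EFinP.
rewrite setTI; apply/funext => x /=; rewrite in_itv/= andbT lte_fin.
case: ifPn => fx0.
  by rewrite ltNge leNye ltNge (le_trans fx0 (expR_ge0 r)).
by rewrite lte_fin -[(r < _)%R]ltr_expR lnK // posrE ltNge.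
Qed.

Lemma measurable_ratio (f g : T -> R) : (forall x, 0 <= g x)%R ->
  measurable_fun setT f -> measurable_fun setT g ->
  measurable_fun setT (fun x => f x / g x)%R.
Proof.
move=> g0 mf mg; apply: measurable_funM => //.
(* the power -1 agrees with the inverse on nonnegative reals, 0 included *)
under eq_fun do rewrite -powR_inv1 //.
exact: (@measurableT_comp _ _ _ _ _ _ (fun y : R => y `^ (-1))%R _ g).
Qed.

End measurable_exp_log.

(** The sample space carrying the natural filtration as its sigma-algebra:
    measurability with respect to the first n observations then becomes the
    ordinary notion, and the closure lemmas for measurable functions apply. *)
Local Notation observed X n := (g_sigma_algebraType
  (\bigcup_(i in [set i | (1 <= i <= n)%N])
        preimage_set_system setT (X i) measurable)).

Section filtration.
Context (dO dE : measure_display) (Omega : measurableType dO)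
  (E : measurableType dE) (X : nat -> Omega -> E).

Local Notation FX n := (observed X n).

Lemma natural_filtrationS m n : (m <= n)%N ->
  natural_filtration X m `<=` natural_filtration X n.
Proof.
move=> mn; apply: sub_sigma_algebra2 => A [i /andP[i1 im] XA].
by exists i => //; rewrite /= i1 (leq_trans im).
Qed.

Lemma natural_filtration_measurable n :
  (forall n, (1 <= n)%N -> measurable_fun setT (X n)) ->
  natural_filtration X n `<=` measurable.
Proof.
move=> mX; apply: smallest_sub; first exact: sigma_algebra_measurable.
by move=> A [i /andP[i1 _] [B mB <-]]; exact: mX.
Qed.

Lemma observation_natural_filtration i n : (1 <= i <= n)%N ->
  measurable_fun (setT : set (FX n)) (X i : FX n -> E).
Proof.
move=> i1n _ B mB; apply: sub_sigma_algebra.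
by exists i => //; exists B.
Qed.

Lemma history_natural_filtration m n : (m <= n)%N ->
  measurable_fun (setT : set (FX n)) (history X m : FX n -> m.-tuple E).
Proof.
move=> mn; apply/measurable_fun_tnthP => i.
rewrite (_ : _ \o _ = X i.+1).
  by apply: observation_natural_filtration; rewrite /= (leq_trans _ mn).
by apply/funext => w /=; rewrite tnth_mktuple.
Qed.

End filtration.

(** * Asymptotic equivalence by squeezing *)

(** Both quotients are compared with the same rate [r].  The bounds also make
    [a] and [b] eventually real and positive, so that the extended quotients
    reduce to real ones. *)
Lemma asymp_squeeze (R : realType) (a b : R -> \bar R) (r : R -> R) :
  (\forall x \near (0:R)%R^'+, (0 < r x)%R) ->
  (\forall x \near (0:R)%R^'+, a x <= b x) ->
  (forall d : R, (0 < d < 1)%R ->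
     \forall x \near (0:R)%R^'+, ((1 - d) * r x)%:E <= a x) ->
  (forall d : R, (0 < d < 1)%R ->
     \forall x \near (0:R)%R^'+, b x <= ((1 + d) * r x)%:E) ->
  (a x / b x @[x --> (0:R)%R^'+] --> 1) /\
  (b x / (r x)%:E @[x --> (0:R)%R^'+] --> 1).
Proof.
move=> r_gt0 ab a_ge b_le.
pose squeezed (d : R) x := exists u v : R, [/\ a x = u%:E, b x = v%:E,
  (0 < r x)%R, (u <= v)%R &
  ((1 - d) * r x <= u)%R /\ (v <= (1 + d) * r x)%R].
have near_squeezed d : (0 < d < 1)%R ->
    \forall x \near (0:R)%R^'+, squeezed d x.
  move=> d01; near=> x.
  have rx : (0 < r x)%R by near: x.
  have abx : a x <= b x by near: x.
  have ax : ((1 - d) * r x)%:E <= a x by near: x; exact: a_ge.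
  have bx : b x <= ((1 + d) * r x)%:E by near: x; exact: b_le.
  have a_fin : a x \is a fin_num.
    rewrite fin_numE; apply/andP; split.
      by rewrite gt_eqF // (lt_le_trans _ ax) // ltNyr.
    by rewrite lt_eqF // (le_lt_trans (le_trans abx bx)) // ltry.
  have b_fin : b x \is a fin_num.
    rewrite fin_numE; apply/andP; split.
      by rewrite gt_eqF // (lt_le_trans _ (le_trans ax abx)) // ltNyr.
    by rewrite lt_eqF // (le_lt_trans bx) // ltry.
  exists (fine (a x)), (fine (b x)); rewrite !fineK //; split=> //.
  - by rewrite -lee_fin !fineK.
  - by rewrite -!lee_fin !fineK.
have quotients d x : (0 < d < 1)%R -> squeezed d x -> exists y z : R,
    [/\ a x / b x = y%:E, b x / (r x)%:E = z%:E,
        (`|1 - y| <= 2 * d)%R & (`|1 - z| <= d)%R].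
  move=> /andP[d0 d1] [u [v [-> -> rx uv [u_ge v_le]]]].
  have u0 : (0 < u)%R by rewrite (lt_le_trans _ u_ge) // mulr_gt0 // subr_gt0.
  have v0 : (0 < v)%R := lt_le_trans u0 uv.
  exists (u / v)%R, (v / r x)%R; rewrite !inver !gt_eqF //; split=> //.
    have uv1 : (u / v <= 1)%R by rewrite ler_pdivrMr // mul1r.
    have uv2 : (1 - 2 * d <= u / v)%R.
      rewrite ler_pdivlMr //; apply: le_trans u_ge; nra.
    by rewrite ger0_norm; lra.
  have vr1 : (1 - d <= v / r x)%R.
    by rewrite ler_pdivlMr // (le_trans u_ge).
  have vr2 : (v / r x <= 1 + d)%R by rewrite ler_pdivrMr.
  by rewrite ler_norml; apply/andP; split; lra.
have half01 : (0 < (2^-1 : R) < 1)%R by rewrite invr_gt0 invf_lt1 ?ltr1n ?ltr0n.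
split; apply/fine_cvgP; split.
- near=> x; have sq : squeezed (2^-1)%R x by near: x; exact: near_squeezed.
  by have [y [z [-> _ _ _]]] := quotients _ _ half01 sq.
- apply/cvgrPdist_le => e e0; pose d := (Num.min (e / 2) 2^-1)%R.
  have d01 : (0 < d < 1)%R.
    rewrite lt_min gt_min invr_gt0 divr_gt0 ?ltr0n //.
    by rewrite invf_lt1 ?ltr1n ?orbT ?ltr0n.
  near=> x; have sq : squeezed d x by near: x; exact: near_squeezed.
  have [y [z [/= -> _ y1 _]]] := quotients _ _ d01 sq.
  apply: (le_trans y1); rewrite mulrC -ler_pdivlMr ?ltr0n //.
  by rewrite ge_min lexx.
- near=> x; have sq : squeezed (2^-1)%R x by near: x; exact: near_squeezed.
  by have [y [z [_ -> _ _]]] := quotients _ _ half01 sq.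
- apply/cvgrPdist_le => e e0; pose d := (Num.min e 2^-1)%R.
  have d01 : (0 < d < 1)%R.
    by rewrite lt_min gt_min invr_gt0 e0 ?ltr0n // invf_lt1 ?ltr1n ?orbT ?ltr0n.
  near=> x; have sq : squeezed d x by near: x; exact: near_squeezed.
  have [y [z [_ /= -> _ z1]]] := quotients _ _ d01 sq.
  by apply: (le_trans z1); rewrite ge_min lexx.
Unshelve. all: by end_near. Qed.

(** * Measurability in a change-point model *)

Section model.
Context (R : realType) (dO dE : measure_display) (Omega : measurableType dO)
  (E : measurableType dE) (mu : {sigma_finite_measure set E -> \bar R})
  (X : nat -> Omega -> E) (Pinf : probability Omega R)
  (P : nat -> probability Omega R)
  (f0 : forall n : nat, n.-1.-tuple E -> E -> R)
  (f1 : nat -> forall n : nat, n.-1.-tuple E -> E -> R).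
Hypothesis model : change_point_model mu X Pinf P f0 f1.

Local Notation F := (natural_filtration X).
Local Notation FX n := (observed X n).
Local Notation Z := (llr X f0 f1).
Local Notation SR := (sr_statistic X f0 f1).

Lemma filtration_measurable n A : F n A -> measurable A.
Proof.
by apply: natural_filtration_measurable; exact: (observation_measurable model).
Qed.

Lemma density_natural_filtration (f : forall n, n.-1.-tuple E -> E -> R) j n :
  (1 <= j <= n)%N ->
  measurable_fun setT (fun p : j.-1.-tuple E * E => f j p.1 p.2) ->
  measurable_fun (setT : set (FX n))
    ((fun w => f j (history X j.-1 w) (X j w)) : FX n -> R).
Proof.
move=> /andP[j1 jn] mf.
suff mg : measurable_fun (setT : set (FX n))
    ((fun w => (history X j.-1 w, X j w)) : FX n -> j.-1.-tuple E * E).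
  exact: (measurableT_comp mf mg).
apply: measurable_fun_pair.
  by apply: history_natural_filtration; rewrite (leq_trans (leq_pred _)).
by apply: observation_natural_filtration; rewrite j1.
Qed.

Lemma llr_natural_filtration k n :
  measurable_fun (setT : set (FX n)) (Z k n : FX n -> \bar R).
Proof.
(* f1 k j is only known to be measurable for k < j, hence the default value *)
pose lr j (w : FX n) : R :=
  if (k < j <= n)%N then (@f1 k j (history X j.-1 w) (X j w) /
    @f0 j (history X j.-1 w) (X j w))%R else 0%R.
rewrite (_ : Z k n = fun w => \sum_(j <- index_iota k.+1 n.+1) lne (lr j w)%:E).
  apply: (@emeasurable_sum _ (FX n)) => j.
  apply: (@measurable_lne_comp _ (FX n) R (lr j)); rewrite /lr.
  have [/andP[kj jn]|_] := boolP (k < j <= n)%N; last exact: measurable_cst.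
  have j1 : (1 <= j <= n)%N by rewrite jn (leq_ltn_trans _ kj).
  have j1' : (1 <= j)%N by case/andP: j1.
  have [mf0 f0_ge0 _] := no_change_density model j1'.
  have [mf1 _ _] := post_change_density model kj.
  apply: measurable_ratio => [w||]; first exact: f0_ge0.
    exact: (density_natural_filtration j1 mf1).
  exact: (density_natural_filtration j1 mf0).
apply/funext => w; rewrite /llr [LHS]big_nat_cond [RHS]big_nat_cond.
apply: eq_bigr => j; rewrite andbT ltnS => kjn.
by rewrite /lr kjn.
Qed.

Lemma sr_statistic_natural_filtration n :
  measurable_fun (setT : set (FX n)) (SR n : FX n -> \bar R).
Proof.
apply: emeasurable_sum => k; apply: measurable_expeR_comp.
exact: llr_natural_filtration.
Qed.

Lemma natural_filtration_fun n (f : Omega -> \bar R) :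
  measurable_fun (setT : set (FX n)) (f : FX n -> \bar R) ->
  measurable_fun setT f.
Proof.
move=> mf _ B mB; rewrite setTI; apply: (@filtration_measurable n).
by rewrite -[_ @^-1` _]setTI; exact: mf.
Qed.

Lemma sr_statistic_threshold_natural_filtration n (h : R) :
  F n [set w | h%:E <= SR n w].
Proof.
rewrite -[X in F n X]setTI.
apply: (@emeasurable_fun_c_infty _ (FX n)) => //.
exact: sr_statistic_natural_filtration.
Qed.

Lemma llr_gt_natural_filtration k n (c : R) : F n [set w | c%:E < Z k n w].
Proof.
rewrite -[X in F n X]setTI.
apply: (@emeasurable_fun_o_infty _ (FX n)) => //.
exact: llr_natural_filtration.
Qed.

Lemma measurable_llr k n : measurable_fun setT (Z k n).
Proof.
apply: (@natural_filtration_fun n); exact: llr_natural_filtration.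
Qed.

Lemma measurable_sr_statistic n : measurable_fun setT (SR n).
Proof.
apply: (@natural_filtration_fun n); exact: sr_statistic_natural_filtration.
Qed.

(** * The law of the observations before the change *)

Lemma measurable_history n : measurable_fun setT (history X n).
Proof.
move=> _ B mB; rewrite setTI; apply: (@filtration_measurable n).
rewrite -[_ @^-1` _]setTI.
exact: (history_natural_filtration (X := X) (leqnn n)).
Qed.

(** Conditional densities are tested only against events of this form. *)
Lemma natural_filtration_history n A : F n A ->
  exists2 B, measurable B & A = history X n @^-1` B.
Proof.
suff : F n `<=` preimage_set_system setT (history X n) measurable.
  by move=> FH /FH[B mB <-]; exists B; rewrite ?setTI.
apply: smallest_sub.
  exact: sigma_algebra_preimage (sigma_algebra_measurable _).
move=> _ [i /andP[i1 iN] [B mB <-]].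
have iN' : (i.-1 < n)%N by rewrite prednK.
exists ((fun t => tnth t (Ordinal iN')) @^-1` B).
  by rewrite -[_ @^-1` _]setTI; exact: measurable_tnth.
by rewrite !setTI; apply/funext => w /=; rewrite tnth_mktuple /= prednK.
Qed.

Lemma measurable_density_integral dH (H : measurableType dH) (f : H -> E -> R)
    (B : set E) : measurable B ->
  measurable_fun setT (fun p : H * E => f p.1 p.2) ->
  (forall h y, 0 <= f h y)%R ->
  measurable_fun setT (fun h => \int[mu]_(y in B) (f h y)%:E).
Proof.
move=> mB mf f_ge0.
pose g (p : H * E) := (f p.1 p.2 * \1_B p.2)%:E.
rewrite (_ : (fun h => _) = fubini_F mu g).
  apply: measurable_fun_fubini_tonelli_F => [|p]; last first.
    by rewrite lee_fin mulr_ge0.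
  apply/measurable_EFinP; apply: measurable_funM => //.
  by apply: measurableT_comp => //; exact: measurable_indic.
apply/funext => h; rewrite /fubini_F [LHS]integral_mkcond [in LHS]epatch_indic.
by apply: eq_integral => y _; rewrite /= -EFinM.
Qed.

(** Up to time k both laws are built from the same conditional densities f0.
    By induction on n, the probability that the first n observations lie in B'
    and the next one in C is the integral over B' of one and the same function
    against the law of the history; these events form a pi-system that
    generates [F n.+1]. *)
Lemma pre_change_law k n A : (n <= k)%N -> F n A -> P k A = Pinf A.
Proof.
elim: n A => [|n IH] A nk FA.
  apply: (g_sigma_algebra_measure_unique [set setT] _ (fun=> setT)) => //.
  - by move=> _ ->; exact: measurableT.
  - by rewrite bigcup_const.
  - by move=> _ _ -> ->; rewrite setTI.
  - move=> _ ->.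
    exact: etrans (probability_setT (P k)) (esym (probability_setT Pinf)).
  - move=> _.
    exact: le_lt_trans (probability_le1 (P k) measurableT) (ltry 1).
  - by apply: sub_sigma_algebra2 FA => ? [i /= /andP[/leq_trans/[apply]]].
pose G := [set C | exists2 A, F n A & exists2 B, measurable B &
  C = A `&` X n.+1 @^-1` B].
have mX i : (1 <= i)%N -> measurable_fun setT (X i).
  exact: observation_measurable model i.
apply: (@g_sigma_algebra_measure_unique _ _ _ G _ (fun=> setT)) => //.
- move=> _ [B FB [C mC ->]]; apply: measurableI; first
    exact: filtration_measurable FB.
  by rewrite -[_ @^-1` _]setTI; exact: mX.
- move=> _; exists setT; first exact: (@measurableT _ (FX n)).
  by exists setT; rewrite ?preimage_setT ?setTI.
- by rewrite bigcup_const.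
- move=> _ _ [B FB [C mC ->]] [B' FB' [C' mC' ->]].
  exists (B `&` B'); first exact: (@measurableI _ (FX n)).
  by exists (C `&` C'); [exact: measurableI|rewrite preimage_setI setIACA].
- move=> _ [B /[dup] FB /natural_filtration_history[B' mB' ->] [C mC ->]].
  have [mf f_ge0 PkE] := pre_change_density model (k := k) (n := n.+1) nk.
  have [_ _ PinfE] := no_change_density model (n := n.+1) isT.
  apply: etrans (PkE _ _ mB' mC) (etrans _ (esym (PinfE _ _ mB' mC))) => /=.
  pose g (h : n.-tuple E) := \int[mu]_(y in C) (@f0 n.+1 h y)%:E.
  have mg : measurable_fun setT g by exact: measurable_density_integral.
  have mH := @measurable_history n.
  have g_ge0 h : 0 <= g h by apply: integral_ge0 => y _; rewrite lee_fin.
  rewrite -[LHS](ge0_integral_pushforward mH _ (f := g)) //; last first.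
    exact: measurable_funTS.
  rewrite -[RHS](ge0_integral_pushforward mH _ (f := g)) //; last first.
    exact: measurable_funTS.
  apply: eq_measure_integral => C' mC' _.
  apply: (IH (history X n @^-1` C')); first exact: ltnW.
  rewrite -[X in F n X]setTI.
  exact: (history_natural_filtration (X := X) (leqnn n)).
- by move=> _; apply: le_lt_trans (probability_le1 (P k) measurableT) (ltry 1).
- apply: smallest_sub FA; first exact: smallest_sigma_algebra.
  move=> C [i /= /andP[i1]]; rewrite leq_eqVlt => /orP[/eqP iE|iN] [B mB <-].
    apply: sub_sigma_algebra; exists setT.
      exact: (@measurableT _ (FX n)).
    by exists B => //; rewrite iE.
  apply: sub_sigma_algebra; exists (setT `&` X i @^-1` B).
    by apply: sub_sigma_algebra; exists i; [rewrite /= i1|exists B].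
  by exists setT; rewrite // preimage_setT setIT.
Qed.

(** * Stopping times *)

Section stopping.
Context (tau : Omega -> \bar R) (tau_stop : stopping_time F tau).

Lemma stopping_le_measurable n : measurable [set w | tau w <= n%:R%:E].
Proof. by apply: (@filtration_measurable n); case: tau_stop => _; exact. Qed.

Lemma stopping_gtE n :
  [set w | n%:R%:E < tau w] = ~` [set w | tau w <= n%:R%:E].
Proof. by apply/seteqP; split => w /=; rewrite ltNge => /negP. Qed.

Lemma stopping_gt_measurable n : measurable [set w | n%:R%:E < tau w].
Proof.
by rewrite stopping_gtE; apply: measurableC; exact: stopping_le_measurable.
Qed.

Lemma stopping_value w (n : nat) : n%:R%:E < tau w -> n.+1%:R%:E <= tau w.
Proof.
have [[[m _ ->]|->] _] := (tau_stop.1 w, tt); last by rewrite leey.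
by rewrite lte_fin ltr_nat lee_fin ler_nat.
Qed.

Lemma stopping_eqE n :
  [set w | tau w = n.+1%:R%:E] =
  [set w | tau w <= n.+1%:R%:E] `\` [set w | tau w <= n%:R%:E].
Proof.
apply/seteqP; split => w /=.
  by move=> ->; rewrite lexx; split=> //; rewrite lee_fin ler_nat ltnn.
move=> [le_tau /negP]; rewrite -ltNge => /stopping_value lt_tau.
by apply/eqP; rewrite eq_le le_tau.
Qed.

Lemma stopping_eq_natural_filtration n : F n.+1 [set w | tau w = n.+1%:R%:E].
Proof.
rewrite stopping_eqE; apply: (@measurableD _ (FX n.+1)).
  by case: tau_stop => _; exact.
apply: (natural_filtrationS (leqnSn n)).
by case: tau_stop => _; exact.
Qed.

Lemma stopping_le0 : [set w | tau w <= 0%:R%:E] = set0.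
Proof.
apply/seteqP; split => w //=.
have [[m m1 ->]|->] := tau_stop.1 w; last by rewrite leye_eq.
by rewrite lee_fin ler_nat leqNgt m1.
Qed.

Lemma stopping_le_sum (Q : probability Omega R) n :
  Q [set w | tau w <= n%:R%:E] =
  \sum_(1 <= m < n.+1) Q [set w | tau w = m%:R%:E].
Proof.
elim: n => [|n IH]; first by rewrite big_geq // stopping_le0 measure0.
rewrite big_nat_recr //= -IH stopping_eqE.
rewrite -measureU; first last.
- by apply/seteqP; split => w //= [? []].
- exact: measurableD (stopping_le_measurable _) (stopping_le_measurable _).
- exact: stopping_le_measurable.
congr (Q _); apply/seteqP; split => w /=.
  by move=> le_tau; have [?|?] := pselect (tau w <= n%:R%:E); [left|right].
by move=> [/le_trans->//|[]//]; rewrite lee_fin ler_nat.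
Qed.

Lemma measurable_stopping : measurable_fun setT tau.
Proof.
apply: (measurability _ (ErealGenOInfty.measurableE R)).
move=> _ [_ [r ->] <-]; rewrite setTI.
have [r0|r0] := ltP r 0%R.
  rewrite (_ : _ @^-1` _ = setT); first exact: measurableT.
  apply/seteqP; split => // w _ /=; rewrite in_itv/= andbT.
  have [[m m1 ->]|->] := tau_stop.1 w; last by rewrite ltry.
  by rewrite lte_fin (lt_le_trans r0).
rewrite (_ : _ @^-1` _ = [set w | (Num.truncn r)%:R%:E < tau w]).
  exact: stopping_gt_measurable.
apply/seteqP; split => w /=; rewrite in_itv/= andbT;
  have [[m m1 ->]|->] := tau_stop.1 w; rewrite ?ltry // !lte_fin ltr_nat.
- by rewrite truncn_lt_nat.
- by rewrite truncn_lt_nat.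
Qed.

(** * Risks as tail sums *)

Lemma measurable_delay nu :
  measurable_fun setT (fun w => maxe (tau w - nu%:R%:E) 0).
Proof.
apply: measurable_maxe => //; apply: emeasurable_funD => //.
exact: measurable_stopping.
Qed.

(** Markov's inequality: on [nu + n < tau] the delay is at least [n.+1], since
    times are integers. *)
Lemma risk_ge_tail nu n :
  n.+1%:R%:E * P nu [set w | (nu + n)%:R%:E < tau w] <= risk P nu tau.
Proof.
have mA := stopping_gt_measurable (nu + n).
rewrite -integral_cst // /risk.
apply: (@le_trans _ _
  (\int[P nu]_(w in [set w | (nu + n)%:R%:E < tau w])
     maxe (tau w - nu%:R%:E) 0)).
  apply: ge0_le_integral => //.
  - by move=> w _; rewrite lee_fin.
  - by apply: measurable_funTS; exact: measurable_delay.
  - move=> w /= lt_tau; rewrite le_max; apply/orP; left; move: lt_tau.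
    have [[m m1 ->]|->] := tau_stop.1 w; last by rewrite addye // leey.
    rewrite lte_fin ltr_nat -EFinB lee_fin lerBrDr -natrD ler_nat.
    by rewrite addSn addnC.
apply: ge0_subset_integral => //; first exact: measurable_delay.
by move=> w _; rewrite le_max lexx orbT.
Qed.

(** The delay after nu counts the n with [nu + n < tau]. *)
Lemma risk_le_tail_sum nu :
  risk P nu tau <= \sum_(0 <= n <oo) P nu [set w | (nu + n)%:R%:E < tau w].
Proof.
have mA n := stopping_gt_measurable (nu + n).
pose A n := [set w | (nu + n)%:R%:E < tau w].
rewrite (eq_eseriesr (g := fun n => \int[P nu]_w (\1_(A n) w)%:E)); last first.
  by move=> n _; rewrite integral_indic ?setIT //; exact: mA.
have mA1 n : measurable_fun setT (fun w => (\1_(A n) w : R)%:E).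
  by apply/measurable_EFinP; apply: measurable_indic; exact: mA.
rewrite -integral_nneseries //.
apply: ge0_le_integral => //.
- by move=> w _; rewrite le_max lexx orbT.
- exact: measurable_delay.
- exact: ge0_emeasurable_sum.
move=> w _; have A_ge0 n : 0 <= (\1_(A n) w : R)%:E by rewrite lee_fin.
have sum_ge M : (nu + M)%:R%:E <= tau w ->
    M%:R%:E <= \sum_(0 <= n <oo) (\1_(A n) w : R)%:E.
  move=> le_tau; apply: le_trans (nneseries_lim_ge M _) => //.
  rewrite (eq_big_nat _ _ (F2 := fun=> 1%R%:E)) => [|n /andP[_ nM]]; last first.
    rewrite indicE mem_set //= /A /= (lt_le_trans _ le_tau) //.
    by rewrite lte_fin ltr_nat ltn_add2l.
  by rewrite sumEFin sumr_const_nat subn0.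
rewrite ge_max nneseries_ge0 ?andbT => [|n _ _]; last exact: A_ge0.
have [[m m1 tauE]|tauE] := tau_stop.1 w.
  rewrite tauE -EFinB.
  have [nu_m|m_nu] := leqP nu m.
    by rewrite -natrB // sum_ge // subnKC // tauE.
  apply: (@le_trans _ _ 0); last exact: nneseries_ge0.
  by rewrite lee_fin subr_le0 ler_nat ltnW.
rewrite tauE addye // leye_eq; apply/eqP/eq_infty => r.
apply: le_trans (sum_ge (Num.truncn r).+1 _); last by rewrite tauE leey.
by rewrite lee_fin ltW // truncnS_gt.
Qed.

(** The event [nu < tau] is decided by the first nu observations, whose law
    does not see a change at nu. *)
Lemma conditional_riskE nu :
  conditional_risk P nu tau = risk P nu tau / Pinf [set w | nu%:R%:E < tau w].
Proof.
rewrite /conditional_risk /risk; congr (_ / _); last first.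
  apply: (@pre_change_law nu nu) => //; rewrite stopping_gtE.
  by apply: sigma_algebraC; case: tau_stop => _; exact.
rewrite integral_mkcond; apply: eq_integral => w _; rewrite patchE.
case: ifPn; rewrite ?(inE, notin_setE).
  by move=> nu_lt; rewrite max_l // sube_ge0 // ltW.
by move=> /negP; rewrite -leNgt => tau_le; rewrite max_r // sube_le0.
Qed.

End stopping.

(** * The Shiryaev-Roberts time and its false alarms *)

Variant sr_time_spec (h : R) w : \bar R -> Prop :=
| SRTimeFinite n of (1 <= n)%N & h%:E <= SR n w &
    (forall m, (1 <= m)%N -> h%:E <= SR m w -> (n <= m)%N) :
    sr_time_spec h w n%:R%:E
| SRTimeInfinite of (forall m, (1 <= m)%N -> SR m w < h%:E) :
    sr_time_spec h w +oo.

Lemma sr_timeP h w : sr_time_spec h w (sr_time X f0 f1 h w).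
Proof.
pose hit m := (1 <= m)%N && (h%:E <= SR m w).
have [ex_hit|no_hit] := pselect (exists m, hit m).
  case: (ex_minnP ex_hit) => n /andP[n1 hn] n_min.
  have hit_min m : (1 <= m)%N -> h%:E <= SR m w -> (n <= m)%N.
    by move=> m1 hm; apply: n_min; rewrite /hit m1.
  rewrite (_ : sr_time _ _ _ _ _ = n%:R%:E); first exact: SRTimeFinite.
  apply/eqP; rewrite eq_le; apply/andP; split.
    by apply: ereal_inf_lbound; exists n.
  apply: le_ereal_inf_tmp => _ [m [m1 hm] <-].
  by rewrite lee_fin ler_nat hit_min.
have never m : (1 <= m)%N -> SR m w < h%:E.
  move=> m1; rewrite ltNge; apply/negP => hm.
  by apply: no_hit; exists m; rewrite /hit m1.
rewrite (_ : sr_time _ _ _ _ _ = +oo); first exact: SRTimeInfinite.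
rewrite /sr_time (_ : image _ _ = set0) ?ereal_inf0 //.
apply/seteqP; split => // _ [m [m1 hm] _] /=.
by have := never m m1; rewrite ltNge hm.
Qed.

Lemma sr_time_stopping h : stopping_time F (sr_time X f0 f1 h).
Proof.
split=> [w|n].
  by case: sr_timeP => [n n1 _ _|_]; [left; exists n|right].
rewrite (_ : [set w | _] =
    \bigcup_(m in [set m | (1 <= m <= n)%N]) [set w | h%:E <= SR m w]).
  apply: (@bigcup_measurable _ (FX n)) => m /= /andP[_ mn].
  apply: (natural_filtrationS mn).
  exact: sr_statistic_threshold_natural_filtration.
apply/seteqP; split => w /=.
  case: sr_timeP => [m m1 hm _|_]; last by rewrite leye_eq.
  by rewrite lee_fin ler_nat => mn; exists m => //=; rewrite m1.
move=> [m /= /andP[m1 mn] hm]; case: sr_timeP => [l l1 hl l_min|never].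
  by rewrite lee_fin ler_nat (leq_trans _ mn) // l_min.
by have := never m m1; rewrite ltNge hm.
Qed.

(** A form of Doob's inequality for the Pinf-martingale [SR n - n].  On the
    event [tau = n] the statistic exceeds h, so h times its probability is at
    most the integral of [SR n] over it; the j-th summand of [SR n] is a
    likelihood ratio and integrates to [P j.-1 (tau = n)].  Summing over n
    first, each of the k change points contributes at most 1. *)
Lemma false_alarm_bound (tau : Omega -> \bar R) (h : R) k :
  stopping_time F tau ->
  (forall n w, tau w = n%:R%:E -> h%:E <= SR n w) -> (0 <= h)%R ->
  h%:E * Pinf [set w | tau w <= k%:R%:E] <= k%:R%:E.
Proof.
move=> tau_stop tau_SR h_ge0.
have FA n : (1 <= n)%N -> F n [set w | tau w = n%:R%:E].
  by case: n => // n _; exact: stopping_eq_natural_filtration.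
rewrite (stopping_le_sum tau_stop) ge0_sume_distrr // big_nat.
apply: (@le_trans _ _ (\sum_(1 <= n < k.+1) \sum_(1 <= j < k.+1)
    P j.-1 [set w | tau w = n%:R%:E])).
  rewrite [leRHS]big_nat; apply: lee_sum => n /andP[n1 nk].
  have mA := filtration_measurable (FA n n1).
  apply: (@le_trans _ _ (\int[Pinf]_(w in [set w | tau w = n%:R%:E]) SR n w)).
    rewrite -integral_cst //; apply: ge0_le_integral => //.
    - by apply: measurable_funTS; exact: measurable_sr_statistic.
    - by move=> w; exact: tau_SR.
  rewrite ge0_integral_sum //; first last.
  - by move=> j w _; exact: expeR_ge0.
  - move=> j; apply: measurable_funTS; apply: measurable_expeR_comp.
    exact: measurable_llr.
  rewrite [leRHS](big_cat_nat (n := n.+1)) //=.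
  rewrite -[leLHS]adde0 leeD ?sume_ge0 // big_nat [leRHS]big_nat.
  apply: lee_sum => j /andP[j1 jn].
  have jn' : (j.-1 < n)%N by rewrite prednK.
  by rewrite -(likelihood_ratio model jn' (FA n n1)).
rewrite exchange_big /=.
under eq_bigr do rewrite -(stopping_le_sum tau_stop).
apply: (@le_trans _ _ (\sum_(1 <= j < k.+1) 1%R%:E)).
  apply: lee_sum => j _; apply: probability_le1.
  exact: stopping_le_measurable.
by rewrite sumEFin sumr_const_nat subSS subn0.
Qed.

Lemma geometric_prior_sum (rho : R) m n : (m <= n)%N ->
  (\sum_(m <= k < n) geometric_prior rho k = (1 - rho) ^+ m - (1 - rho) ^+ n)%R.
Proof.
elim: n => [|n IH]; first by rewrite leqn0 => /eqP ->; rewrite big_geq // subrr.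
rewrite leq_eqVlt => /orP[/eqP ->|mn]; first by rewrite big_geq // subrr.
rewrite big_nat_recr //= IH // /geometric_prior exprS; ring.
Qed.

Lemma geometric_prior_mean (rho : R) n : (rho != 0)%R ->
  (\sum_(1 <= k < n.+1) k%:R * geometric_prior rho k =
   ((1 - rho) - (1 - rho) ^+ n.+1) / rho - n%:R * (1 - rho) ^+ n.+1)%R.
Proof.
move=> rho0; elim: n => [|n IH]; first by rewrite big_geq // expr1; field.
rewrite big_nat_recr //= IH /geometric_prior !exprS -natr1.
by field.
Qed.

Lemma geometric_prior_ge0 (rho : R) k : (0 < rho < 1)%R ->
  (0 <= geometric_prior rho k)%R.
Proof.
by move=> /andP[r0 r1]; rewrite mulr_ge0 ?exprn_ge0 ?subr_ge0 // ltW.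
Qed.

(** [Pinf (tau <= k)] is nondecreasing in k, so the terms k >= m of the
    constraint alone give [Pinf (tau <= m)] times the prior mass of [[m, oo)],
    which is [(1 - rho) ^ m]. *)
Lemma Delta_false_alarm (alpha rho : R) (tau : Omega -> \bar R) m :
  (0 < rho < 1)%R -> Delta X Pinf alpha rho tau ->
  ((1 - rho) ^+ m)%:E * Pinf [set w | tau w <= m%:R%:E] <= alpha%:E.
Proof.
move=> rho01 [tau_stop alarm].
have term_ge0 k : 0 <= (geometric_prior rho k)%:E *
    Pinf [set w | tau w <= k%:R%:E].
  by rewrite mule_ge0 // lee_fin geometric_prior_ge0.
case: m => [|m].
  rewrite (stopping_le0 tau_stop) measure0 mule0.
  by apply: le_trans alarm; apply: nneseries_ge0 => k _ _; exact: term_ge0.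
have finp k : Pinf [set w | tau w <= k%:R%:E] \is a fin_num.
  by apply: fin_num_measure; exact: (stopping_le_measurable tau_stop).
rewrite -(fineK (finp m.+1)); set p := fine _.
have p_ge0 : (0 <= p)%R by rewrite fine_ge0.
have rho1 : (`|1 - rho| < 1)%R.
  by case/andP: rho01 => ? ?; rewrite ger0_norm; lra.
have cvgp : (fun n => ((1 - rho) ^+ m.+1 - (1 - rho) ^+ n) * p)%R @ \oo
    --> (((1 - rho) ^+ m.+1 - 0) * p)%R.
  by apply: cvgMl; apply: cvgB; [exact: cvg_cst|exact: cvg_expr].
rewrite -EFinM lee_fin -[X in (X * _)%R]subr0.
apply: (cvgr_to_le cvgp); exists m.+1 => // n /= mn.
rewrite -geometric_prior_sum // mulr_suml -lee_fin -sumEFin.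
apply: le_trans alarm; apply: le_trans (nneseries_lim_ge n _) => //.
rewrite [leRHS](big_cat_nat (n := m.+1)) //=.
rewrite -[leLHS]add0e leeD ?sume_ge0 // big_nat [leRHS]big_nat.
apply: lee_sum => k /andP[mk _]; rewrite EFinM fineK //.
apply: lee_wpmul2l; first by rewrite lee_fin geometric_prior_ge0.
apply: le_measure; rewrite ?inE; try exact: (stopping_le_measurable tau_stop).
by move=> w /= /le_trans; apply; rewrite lee_fin ler_nat.
Qed.

(** By [false_alarm_bound] the average false-alarm probability is at most the
    mean [(1 - rho) / rho] of the prior divided by h, which for this threshold
    is [alpha * (1 - rho) / (1 - alpha)]. *)
Lemma sr_time_Delta (alpha rho : R) : (0 < alpha < 1)%R ->
  (alpha <= rho < 1)%R ->
  Delta X Pinf alpha rho (sr_time X f0 f1 (sr_threshold alpha rho)).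
Proof.
move=> /andP[a0 a1] /andP[ar r1]; have r0 := lt_le_trans a0 ar.
have T_stop := sr_time_stopping (sr_threshold alpha rho).
have h_gt0 : (0 < sr_threshold alpha rho)%R.
  by rewrite divr_gt0 ?mulr_gt0 // subr_gt0.
set h := sr_threshold alpha rho in T_stop h_gt0 *.
split=> //.
have alarm k : Pinf [set w | sr_time X f0 f1 h w <= k%:R%:E] <=
    (h^-1 * k%:R)%:E.
  rewrite EFinM lee_pdivlMl //; apply: false_alarm_bound => //; last exact: ltW.
  move=> n w; case: sr_timeP => // m _ hm _ [/eqP].
  by rewrite eqr_nat => /eqP <-.
have rho01 : (0 < rho < 1)%R by rewrite r0.
apply: lime_le.
  apply: is_cvg_nneseries => n _ _.
  by rewrite mule_ge0 // lee_fin geometric_prior_ge0.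
exists 1%N => // -[//|n] _ /=.
apply: (@le_trans _ _
  (\sum_(1 <= k < n.+1) (h^-1 * (k%:R * geometric_prior rho k))%:E)).
  apply: lee_sum => k _.
  rewrite [leRHS](_ : _ = (geometric_prior rho k)%:E * (h^-1 * k%:R)%:E);
    last first.
    by rewrite -EFinM; congr EFin; ring.
  by apply: lee_wpmul2l => //; rewrite lee_fin geometric_prior_ge0.
rewrite sumEFin lee_fin -mulr_sumr geometric_prior_mean ?gt_eqF //.
rewrite mulrC ler_pdivrMr //.
have q_ge0 : (0 <= (1 - rho) ^+ n.+1)%R by rewrite exprn_ge0 ?subr_ge0 ?ltW.
apply: (@le_trans _ _ ((1 - rho) / rho)%R).
  rewrite lerBlDr ler_wpDr ?mulr_ge0 // ler_pM2r ?invr_gt0 //.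
  by rewrite gerBl.
rewrite /h /sr_threshold mulrCA invfM.
rewrite [X in (_ <= X)%R](_ : _ = (1 - alpha) / rho)%R; last by field; lra.
by rewrite ler_pM2r ?invr_gt0 // lerB.
Qed.

(** * Bounds for a fixed level *)

(** The general term of the series in [uniform_complete_convergence]. *)
Definition llr_deviation (I eps : R) (n : nat) : \bar R :=
  ereal_sup (range (fun k : nat =>
    P k [set w | eps%:E <
               `| (n%:R^-1)%R%:E * Z k (k + n)%N w - I%:E |])).

Lemma deviation_above (I eps : R) n (x : \bar R) : (0 < n)%N ->
  ((I + eps) * n%:R)%:E < x -> eps%:E < `|(n%:R^-1)%R%:E * x - I%:E|.
Proof.
move=> n0; have n0' : (0 < n%:R :> R)%R by rewrite ltr0n.
case: x => [r|_|//]; last first.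
  by rewrite gt0_muley ?lte_fin ?invr_gt0 // addye //= ltry.
rewrite !lte_fin => /= rgt; apply: lt_le_trans (ler_norm _).
by rewrite ltrBrDl mulrC ltr_pdivlMr.
Qed.

Lemma deviation_below (I eps : R) n (x : \bar R) : (0 < n)%N ->
  x < ((I - eps) * n%:R)%:E -> eps%:E < `|(n%:R^-1)%R%:E * x - I%:E|.
Proof.
move=> n0; have n0' : (0 < n%:R :> R)%R by rewrite ltr0n.
case: x => [r|//|_]; last first.
  by rewrite gt0_muleNy ?lte_fin ?invr_gt0 // addNye //= ltry.
rewrite !lte_fin => /= rlt; rewrite distrC; apply: lt_le_trans (ler_norm _).
by rewrite ltrBrDl -ltrBrDr mulrC ltr_pdivrMr.
Qed.

Lemma measurable_deviation (I eps : R) n k m :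
  measurable [set w | eps%:E < `| (n%:R^-1)%R%:E * Z k m w - I%:E |].
Proof.
rewrite -[X in measurable X]setTI; apply: emeasurable_fun_o_infty => //.
apply: measurableT_comp => //; apply: emeasurable_funD => //.
by apply: emeasurable_funM => //; exact: measurable_llr.
Qed.

Lemma llr_deviation_ge (I eps : R) n k (A : set Omega) : measurable A ->
  A `<=` [set w | eps%:E < `| (n%:R^-1)%R%:E * Z k (k + n) w - I%:E |] ->
  P k A <= llr_deviation I eps n.
Proof.
move=> mA Adev; apply: (@le_trans _ _
  (P k [set w | eps%:E < `| (n%:R^-1)%R%:E * Z k (k + n)%N w - I%:E |])).
  by apply: le_measure; rewrite ?inE //; exact: measurable_deviation.
by apply: ereal_sup_ubound; exists k.
Qed.

Lemma llr_deviation_ge0 (I eps : R) n : 0 <= llr_deviation I eps n.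
Proof. by apply: le_trans (@llr_deviation_ge I eps n 0 set0 _ _) => //. Qed.

(** Where the log-likelihood ratio is at most c, the law [P k] of the first
    n observations has density at most [exp c] with respect to [Pinf]. *)
Lemma change_of_measure k n (c : R) A : (k < n)%N -> F n A ->
  P k A <= P k [set w | c%:E < Z k n w] + (expR c)%:E * Pinf A.
Proof.
move=> kn FA; have mA := filtration_measurable FA.
set B := [set w | c%:E < Z k n w].
have FB : F n B by exact: llr_gt_natural_filtration.
have mB := filtration_measurable FB.
have FAB : F n (A `\` B) by exact: (@measurableD _ (FX n)).
have mAB := filtration_measurable FAB.
apply: (@le_trans _ _ (P k (B `|` (A `\` B)))).
  apply: le_measure; rewrite ?inE //; first exact: measurableU.
  by move=> w Aw; have [Bw|Bw] := pselect (B w); [left|right].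
apply: le_trans (measureU2 _ mB mAB) _; apply: leeD => //.
apply: (@le_trans _ _ (\int[Pinf]_(w in A `\` B) expeR (Z k n w))).
  by rewrite -(likelihood_ratio model kn FAB).
apply: (@le_trans _ _ (\int[Pinf]_(w in A `\` B) cst (expR c)%:E w)).
  apply: ge0_le_integral => //.
  - by move=> w _; exact: expeR_ge0.
  - apply: measurable_funTS; apply: measurable_expeR_comp.
    exact: measurable_llr.
  - move=> w [_ ZleP]; rewrite -[leRHS]/(expeR c%:E) lee_expeR leNgt.
    exact/negP.
rewrite integral_cst //; apply: lee_wpmul2l; first by rewrite lee_fin expR_ge0.
by apply: le_measure; rewrite ?inE // => w [].
Qed.

(** [(I + eps) n] is the upper edge of the typical range of the log-likelihood
    ratio of n post-change observations, so exceeding it is a deviation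
    event. *)
Lemma early_stopping_bound (I eps : R) (tau : Omega -> \bar R) (nu n : nat) :
  (0 < n)%N -> stopping_time F tau ->
  P nu [set w | tau w <= (nu + n)%:R%:E] <=
  llr_deviation I eps n +
  (expR ((I + eps) * n%:R))%:E * Pinf [set w | tau w <= (nu + n)%:R%:E].
Proof.
move=> n0 tau_stop.
have nu_n : (nu < nu + n)%N by rewrite -[ltnLHS]addn0 ltn_add2l.
apply: le_trans (change_of_measure ((I + eps) * n%:R) nu_n (tau_stop.2 _)) _.
apply: leeD => //; apply: llr_deviation_ge => [|w /=].
  by apply: (@filtration_measurable (nu + n)); exact: llr_gt_natural_filtration.
exact: deviation_above.
Qed.

Lemma risk_lower_bound (I eps alpha rho : R) (tau : Omega -> \bar R)
    (nu n : nat) : (0 < n)%N -> (0 < rho < 1)%R -> Delta X Pinf alpha rho tau ->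
  n.+1%:R%:E * (1 - (llr_deviation I eps n +
    (expR ((I + eps) * n%:R) * alpha / (1 - rho) ^+ (nu + n))%:E))
  <= risk P nu tau.
Proof.
move=> n0 rho01 tauD; have tau_stop := tauD.1.
apply: le_trans (risk_ge_tail tau_stop nu n).
apply: lee_wpmul2l; first by rewrite lee_fin.
have mA := stopping_le_measurable tau_stop (nu + n).
rewrite (stopping_gtE tau) probability_setC // leeB //.
apply: le_trans (early_stopping_bound I eps nu n0 tau_stop) _.
apply: leeD => //; rewrite -mulrA EFinM; apply: lee_wpmul2l.
  by rewrite lee_fin expR_ge0.
rewrite mulrC EFinM lee_pdivlMl; last first.
  by case/andP: rho01 => *; rewrite exprn_gt0 // subr_gt0.
exact: (Delta_false_alarm _ rho01 tauD).
Qed.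

Lemma sr_statistic_ge k n w : (k < n)%N -> expeR (Z k n w) <= SR n w.
Proof.
move=> kn; rewrite /sr_statistic (bigD1_seq k.+1) ?iota_uniq //=; last first.
  by rewrite mem_index_iota.
by rewrite leeDl // sume_ge0 // => j _; exact: expeR_ge0.
Qed.

(** If T has not stopped at [nu + m] then the likelihood ratio of the last m
    observations is below h, which is a deviation event for each m >= n; the
    first n tail probabilities are bounded by 1. *)
Lemma sr_risk_upper_bound (I eps h : R) (nu n : nat) :
  (0 < n)%N -> (eps <= I)%R -> (h <= expR ((I - eps) * n%:R))%R ->
  risk P nu (sr_time X f0 f1 h) <=
  n%:R%:E + \sum_(1 <= m <oo) llr_deviation I eps m.
Proof.
move=> n0 eps_I h_le; have T_stop := sr_time_stopping h.
have mA m := stopping_gt_measurable T_stop m.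
apply: le_trans (risk_le_tail_sum T_stop nu) _.
rewrite (nneseries_split 0 n) // add0n leeD //.
  apply: (@le_trans _ _ (\sum_(0 <= m < n) 1%R%:E)); last first.
    by rewrite sumEFin sumr_const_nat subn0.
  by apply: lee_sum => m _; exact: probability_le1.
rewrite [leRHS](nneseries_split 1 n.-1) => [|m _]; last first.
  exact: llr_deviation_ge0.
rewrite add1n prednK // -[leLHS]add0e leeD //.
  by apply: sume_ge0 => m _; exact: llr_deviation_ge0.
rewrite eseries_cond [leRHS]eseries_cond; apply: lee_nneseries => // m nm.
apply: llr_deviation_ge => // w /=.
have m0 : (0 < m)%N := leq_trans n0 nm.
move=> lt_T; apply: deviation_below => //.
have SR_lt : SR (nu + m) w < h%:E.
  have nu_m : (1 <= nu + m)%N by rewrite addn_gt0 m0 orbT.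
  rewrite ltNge; apply/negP => hm; move: lt_T.
  case: sr_timeP => [l l1 hl l_min|never _].
    by rewrite lte_fin ltr_nat ltnNge l_min.
  by have := never _ nu_m; rewrite ltNge hm.
have nu_m : (nu < nu + m)%N by rewrite -[ltnLHS]addn0 ltn_add2l.
rewrite -lte_expeR /=; apply: (le_lt_trans (sr_statistic_ge w nu_m)).
apply: (lt_le_trans SR_lt); rewrite lee_fin (le_trans h_le) // ler_expR.
by rewrite ler_wpM2l ?subr_ge0 // ler_nat.
Qed.

(** * Asymptotics at vanishing false-alarm level *)

Context (rho : R -> R)
  (rho01 : forall alpha : R, (0 < alpha < 1)%R -> (0 < rho alpha < 1)%R)
  (I : R) (I_gt0 : (0 < I)%R)
  (hconv : uniform_complete_convergence X P f0 f1 I)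
  (rho_cvg0 : rho alpha @[alpha --> (0:R)%R^'+] --> (0:R)%R)
  (log_rho : (`|ln (rho alpha)| / `|ln alpha|)%R
               @[alpha --> (0:R)%R^'+] --> (0:R)%R).

Let D (alpha : R) := Delta X Pinf alpha (rho alpha).
Let T (alpha : R) := sr_time X f0 f1 (sr_threshold alpha (rho alpha)).

Lemma near_unit : \forall alpha \near (0:R)%R^'+, (0 < alpha < 1)%R.
Proof.
near=> alpha; apply/andP; split; near: alpha.
  exact: nbhs_right_gt.
exact: nbhs_right_lt.
Unshelve. all: by end_near. Qed.

Lemma near_ln_large (M : R) :
  \forall alpha \near (0:R)%R^'+, (M <= `|ln alpha|)%R.
Proof.
near=> alpha; have /andP[a0 a1] : (0 < alpha < 1)%R.
  by near: alpha; exact: near_unit.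
have aM : (alpha < expR (- M))%R.
  by near: alpha; apply: nbhs_right_lt; exact: expR_gt0.
have lna : (ln alpha <= 0)%R by rewrite ln_le0 // ltW.
by rewrite ler0_norm // lerNr ltW // -ltr_expR lnK.
Unshelve. all: by end_near. Qed.

Lemma expR_ln_norm (alpha : R) : (0 < alpha < 1)%R ->
  expR (- `|ln alpha|) = alpha.
Proof.
by move=> /andP[a0 a1]; rewrite ler0_norm ?ln_le0 ?ltW // opprK lnK.
Qed.

Lemma near_ln_rho (eta : R) : (0 < eta)%R ->
  \forall alpha \near (0:R)%R^'+, (`|ln (rho alpha)| <= eta * `|ln alpha|)%R.
Proof.
move=> eta0; near=> alpha.
have lna : (1 <= `|ln alpha|)%R by near: alpha; exact: near_ln_large.
rewrite -ler_pdivrMr ?(lt_le_trans _ lna) //; apply: ltW.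
by near: alpha; apply: (cvgr_lt _ log_rho).
Unshelve. all: by end_near. Qed.

(** [log rho] is negligible against [log alpha], so rho exceeds every fixed
    power of alpha eventually. *)
Lemma near_le_rho : \forall alpha \near (0:R)%R^'+, (alpha <= rho alpha)%R.
Proof.
near=> alpha; have a01 : (0 < alpha < 1)%R by near: alpha; exact: near_unit.
have : (`|ln (rho alpha)| <= 1 * `|ln alpha|)%R.
  by near: alpha; exact: near_ln_rho.
rewrite mul1r => ln_le.
rewrite -(expR_ln_norm (rho01 a01)) -[leLHS](expR_ln_norm a01).
by rewrite ler_expR lerN2.
Unshelve. all: by end_near. Qed.

Lemma near_ln_threshold (eta : R) : (0 < eta)%R ->
  \forall alpha \near (0:R)%R^'+,
    (sr_threshold alpha (rho alpha) <= expR ((1 + eta) * `|ln alpha|))%R.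
Proof.
move=> eta0; near=> alpha.
have a01 : (0 < alpha < 1)%R by near: alpha; exact: near_unit.
have r01 := rho01 a01; have /andP[a0 a1] := a01; have /andP[r0 r1] := r01.
have ln_le : (`|ln (rho alpha)| <= eta * `|ln alpha|)%R.
  by near: alpha; exact: near_ln_rho.
rewrite /sr_threshold ler_pdivrMr ?mulr_gt0 //.
apply: (@le_trans _ _ 1%R); first by lra.
rewrite [X in (_ <= _ * X)%R](_ : _ =
    expR (- `|ln (rho alpha)|) * expR (- `|ln alpha|))%R.
  by rewrite -!expRD -[leLHS]expR0 ler_expR; lra.
by rewrite !expR_ln_norm.
Unshelve. all: by end_near. Qed.

Lemma near_ln_survival (eta : R) : (0 < eta)%R ->
  \forall alpha \near (0:R)%R^'+, (- ln (1 - rho alpha) <= eta)%R.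
Proof.
move=> eta0; near=> alpha.
have a01 : (0 < alpha < 1)%R by near: alpha; exact: near_unit.
have /andP[r0 r1] := rho01 a01.
have r_small : (rho alpha < 1 - expR (- eta))%R.
  near: alpha; apply: (cvgr_lt _ rho_cvg0).
  by rewrite subr_gt0 -expR0 ltr_expR oppr_lt0.
have q0 : (0 < 1 - rho alpha)%R by rewrite subr_gt0.
by rewrite lerNl -ler_expR lnK //; lra.
Unshelve. all: by end_near. Qed.

Lemma near_Delta_sr_time : \forall alpha \near (0:R)%R^'+, D alpha (T alpha).
Proof.
near=> alpha; have a01 : (0 < alpha < 1)%R by near: alpha; exact: near_unit.
apply: sr_time_Delta => //; apply/andP; split.
  by near: alpha; exact: near_le_rho.
by case/andP: (rho01 a01).
Unshelve. all: by end_near. Qed.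

Lemma llr_deviation_small (eps x : R) : (0 < eps)%R -> (0 < x)%R ->
  exists N, forall n, (N <= n)%N -> llr_deviation I eps n <= x%:E.
Proof.
move=> eps0 x0.
have sum_fin : \sum_(0 <= n <oo | (0 < n)%N) llr_deviation I eps n < +oo.
  by have := hconv eps0; rewrite eseries_cond.
have tail := nneseries_tail_cvg sum_fin (fun n _ => llr_deviation_ge0 I eps n).
have [tail_fin tail_cvg] := (fine_cvgP _ _).1 tail.
have [N1 _ fin_N1] := tail_fin.
have [N2 _ lt_N2] := cvgr_lt _ tail_cvg _ x0.
exists (maxn 1 (maxn N1 N2)) => n; rewrite !geq_max => /and3P[n0 n1 n2].
apply: (@le_trans _ _ (\sum_(n <= k <oo | (0 < k)%N) llr_deviation I eps k)).
  apply: le_trans (nneseries_lim_ge n.+1 _) => [|k _]; last first.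
    by move=> _; exact: llr_deviation_ge0.
  by rewrite big_mkcond big_nat1 n0.
by rewrite -(fineK (fin_N1 n n1)) lee_fin ltW //; exact: lt_N2.
Qed.

(** With [e = d / 2] and [n] the integer part of [x = (1 - e) |log alpha| / I],
    the exponent of [exp ((1 + e) I n) * alpha / (1 - rho) ^ (nu + n)] is at
    most [- e ^ 2 |log alpha| + (nu + n) eta] once [- log (1 - rho) <= eta].
    The choice [eta = e ^ 2 I / 2] keeps [n eta] below half of the first term,
    and [nu eta] is a constant. *)
Lemma risk_asymp_lower nu (d : R) : (0 < d < 1)%R ->
  \forall alpha \near (0:R)%R^'+, forall tau, D alpha tau ->
    ((1 - d) * (`|ln alpha| / I))%:E <= risk P nu tau.
Proof.
move=> /andP[d0 d1]; pose e := (d / 2)%R.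
have e0 : (0 < e)%R by rewrite divr_gt0.
have e1 : (e < 1)%R by rewrite /e; lra.
have de_ge0 : (0 <= 1 - d / 2)%R by lra.
have de_sqr : (1 - d <= (1 - d / 2) * (1 - d / 2))%R by nra.
have d4 : (0 < d / 4)%R by rewrite divr_gt0.
have [N0 dev_N0] := llr_deviation_small (mulr_gt0 e0 I_gt0) d4.
pose eta := (e ^+ 2 * I / 2)%R.
have eta0 : (0 < eta)%R by rewrite divr_gt0 ?mulr_gt0 ?exprn_gt0.
near=> alpha => tau tauD.
have a01 : (0 < alpha < 1)%R by near: alpha; exact: near_unit.
have r01 := rho01 a01; have /andP[r0 r1] := r01.
have q0 : (0 < 1 - rho alpha)%R by rewrite subr_gt0.
have ln_q : (- ln (1 - rho alpha) <= eta)%R.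
  by near: alpha; exact: near_ln_survival.
pose L := (`|ln alpha|)%R.
have L_ge0 : (0 <= L)%R by exact: normr_ge0.
pose x := ((1 - e) * L / I)%R.
have x_ge0 : (0 <= x)%R by rewrite divr_ge0 ?mulr_ge0 ?subr_ge0 // ltW.
have x_large : (N0.+1%:R <= x)%R.
  rewrite ler_pdivlMr // -ler_pdivrMl ?subr_gt0 //.
  by rewrite /L; near: alpha; exact: near_ln_large.
pose n := Num.truncn x.
have n_le : (n%:R <= x)%R by rewrite truncn_le.
have n_gt : (x < n.+1%:R)%R by exact: truncnS_gt.
have n_N0 : (N0 < n)%N by rewrite /n truncn_ge_nat.
have nI : (n%:R * I <= (1 - e) * L)%R by rewrite -ler_pdivlMr.
have n0 : (0 < n)%N by exact: leq_ltn_trans n_N0.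
apply: le_trans (risk_lower_bound I (e * I) nu n0 r01 tauD).
have alarm : (expR ((I + e * I) * n%:R) * alpha / (1 - rho alpha) ^+ (nu + n)
    <= d / 4)%R.
  rewrite -{1}(expR_ln_norm a01) -[X in (X ^+ _)%R]lnK // -expRM_natl -expRN.
  rewrite -!expRD -[leRHS]lnK // ler_expR -/L.
  have L_large : ((nu%:R * eta - ln (d / 4)) / (e ^+ 2 / 2) <= L)%R.
    by rewrite /L; near: alpha; exact: near_ln_large.
  rewrite ler_pdivrMr ?divr_gt0 ?exprn_gt0 // in L_large.
  have ln_q' : ((nu + n)%:R * - ln (1 - rho alpha) <= (nu + n)%:R * eta)%R.
    by rewrite ler_wpM2l.
  have n_eta : (n%:R * eta <= e ^+ 2 / 2 * L)%R.
    rewrite (_ : n%:R * eta = e ^+ 2 / 2 * (n%:R * I))%R; last first.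
      by rewrite /eta; ring.
    apply: ler_wpM2l; first by rewrite divr_ge0 ?exprn_ge0 // ltW.
    apply: (le_trans nI).
    by rewrite ler_piMl // gerBl ltW.
  have nI' : ((1 + e) * (n%:R * I) <= (1 + e) * ((1 - e) * L))%R.
    by rewrite ler_wpM2l // addr_ge0 // ltW.
  have -> : ((I + e * I) * n%:R = (1 + e) * (n%:R * I))%R by ring.
  rewrite natrD in ln_q' *; lra.
apply: (@le_trans _ _ (n.+1%:R%:E * (1 - d / 2)%:E)).
  rewrite -EFinM lee_fin; apply: (@le_trans _ _ (x * (1 - d / 2)))%R.
    rewrite /x /e -/L (_ : _ * L / I * _ =
      (1 - d / 2) * (1 - d / 2) * (L / I))%R; last by ring.
    by rewrite ler_wpM2r // divr_ge0 // ltW.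
  by rewrite ler_wpM2r // ltW.
apply: lee_wpmul2l; first by rewrite lee_fin.
rewrite EFinB leeB // (_ : d / 2 = d / 4 + d / 4)%R; last by field.
by rewrite EFinD leeD ?lee_fin // dev_N0 // ltnW.
Unshelve. all: by end_near. Qed.

(** eps is chosen so that [I - eps = I / (1 + eta)]; with
    [log h <= (1 + eta) |log alpha|], the number of steps needed is then
    [x = (1 + eta) ^ 2 |log alpha| / I], and [d = 4 eta] leaves room for the
    constant [1 + C]. *)
Lemma risk_asymp_upper (d : R) : (0 < d < 1)%R ->
  \forall alpha \near (0:R)%R^'+, forall nu,
    risk P nu (T alpha) <= ((1 + d) * (`|ln alpha| / I))%:E.
Proof.
move=> /andP[d0 d1]; pose eta := (d / 4)%R.
have eta0 : (0 < eta)%R by rewrite divr_gt0.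
have eta1 : (0 < 1 + eta)%R by rewrite addr_gt0.
pose eps := (I - I / (1 + eta))%R.
have eps0 : (0 < eps)%R.
  by rewrite subr_gt0 ltr_pdivrMr // ltr_pMr // ltrDl.
have eps_I : (eps <= I)%R by rewrite gerBl divr_ge0 // ltW.
have epsE : (I - eps = I / (1 + eta))%R by rewrite /eps; ring.
pose C := fine (\sum_(1 <= m <oo) llr_deviation I eps m).
have CE : \sum_(1 <= m <oo) llr_deviation I eps m = C%:E.
  rewrite fineK // ge0_fin_numE; first exact: hconv.
  by apply: nneseries_ge0 => m _ _; exact: llr_deviation_ge0.
near=> alpha => nu.
pose L := (`|ln alpha|)%R.
have L_ge0 : (0 <= L)%R by exact: normr_ge0.
have h_le : (sr_threshold alpha (rho alpha) <= expR ((1 + eta) * L))%R.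
  by rewrite /L; near: alpha; exact: near_ln_threshold.
have L_large : ((1 + C) * (4 * I / d) <= L)%R.
  by rewrite /L; near: alpha; exact: near_ln_large.
pose x := ((1 + eta) ^+ 2 * (L / I))%R.
have LI_ge0 : (0 <= L / I)%R by rewrite divr_ge0 // ltW.
have x_ge0 : (0 <= x)%R by rewrite mulr_ge0 ?exprn_ge0 // ltW.
pose n := (Num.truncn x).+1.
have n_gt : (x < n%:R)%R by exact: truncnS_gt.
have n_le : (n%:R <= x + 1)%R by rewrite /n -natr1 lerD2r truncn_le.
apply: (le_trans (@sr_risk_upper_bound I eps _ nu n _ eps_I _)) => //.
  apply: (le_trans h_le); rewrite ler_expR epsE.
  apply: (@le_trans _ _ (I / (1 + eta) * x)%R); last first.
    by rewrite ler_wpM2l ?ltW // divr_gt0.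
  rewrite /x le_eqVlt; apply/orP; left; apply/eqP; field.
  by rewrite !gt_eqF.
rewrite CE -EFinD lee_fin.
have L_large' : (1 + C <= d / 4 * (L / I))%R.
  rewrite -ler_pdivlMr ?divr_gt0 ?mulr_gt0 // in L_large.
  apply: (le_trans L_large); rewrite le_eqVlt; apply/orP; left; apply/eqP.
  field.
  by rewrite !gt_eqF.
apply: (@le_trans _ _ (x + (1 + C))%R); first by lra.
apply: (le_trans (lerD (lexx _) L_large')); rewrite /x -mulrDl ler_wpM2r //.
by rewrite /eta; nra.
Unshelve. all: by end_near. Qed.

Lemma conditional_risk_bounds (tau : Omega -> \bar R) nu (x : R) :
  stopping_time F tau -> (x < 1)%R ->
  Pinf [set w | tau w <= nu%:R%:E] <= x%:E ->
  risk P nu tau <= conditional_risk P nu tau <= risk P nu tau * ((1 - x)^-1)%:E.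
Proof.
move=> tau_stop x1 early_le.
have mA := stopping_le_measurable tau_stop nu.
have finA : Pinf [set w | tau w <= nu%:R%:E] \is a fin_num.
  exact: fin_num_measure.
have risk_ge0 : 0 <= risk P nu tau.
  by apply: integral_ge0 => w _; rewrite le_max lexx orbT.
rewrite (conditional_riskE tau_stop) (stopping_gtE tau) probability_setC //.
have early_ge0 : 0 <= Pinf [set w | tau w <= nu%:R%:E] by exact: measure_ge0.
rewrite -(fineK finA) in early_le early_ge0 *.
move: (fine _) early_le early_ge0 => q; rewrite !lee_fin => q_le q_ge0.
have q1 : (0 < 1 - q)%R by lra.
rewrite -EFinB inver gt_eqF //; apply/andP; split.
  rewrite -[leLHS]mule1; apply: lee_wpmul2l => //.
  by rewrite lee_fin invf_ge1 // gerBl.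
apply: lee_wpmul2l => //; rewrite lee_fin lef_pV2 ?posrE //; lra.
Qed.

(** The assumption on kstar says that [alpha / (1 - rho) ^ kstar] tends to 0,
    and [(1 - rho) ^ nu] only grows when nu decreases: this is what makes
    [P nu (nu < tau)] tend to 1 uniformly. *)
Lemma near_early_stopping (kstar : R -> nat) (x : R) : (0 < x)%R ->
  (`|ln alpha| + (kstar alpha)%:R * ln (1 - rho alpha))%R
       @[alpha --> (0:R)%R^'+] --> +oo%R ->
  \forall alpha \near (0:R)%R^'+, forall tau nu, D alpha tau ->
    (nu <= kstar alpha)%N -> Pinf [set w | tau w <= nu%:R%:E] <= x%:E.
Proof.
move=> x0 /cvgryPge kstar_cvg; near=> alpha => tau nu tauD nu_k.
have a01 : (0 < alpha < 1)%R by near: alpha; exact: near_unit.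
have r01 := rho01 a01; have /andP[r0 r1] := r01.
have q0 : (0 < 1 - rho alpha)%R by rewrite subr_gt0.
have large : (- ln x <= `|ln alpha| + (kstar alpha)%:R * ln (1 - rho alpha))%R.
  by near: alpha; exact: kstar_cvg.
have := Delta_false_alarm nu r01 tauD.
rewrite -lee_pdivlMl ?exprn_gt0 // => /le_trans; apply.
rewrite -EFinM lee_fin mulrC ler_pdivrMr ?exprn_gt0 //.
rewrite -{1}(expR_ln_norm a01) -[X in (X ^+ _)%R]lnK // -expRM_natl.
rewrite -[X in (X * _)%R]lnK // -expRD ler_expR.
have : ((kstar alpha)%:R * ln (1 - rho alpha) <= nu%:R * ln (1 - rho alpha))%R.
  by rewrite ler_wnM2r ?ler_nat // ln_le0 // gerBl ltW.
lra.
Unshelve. all: by end_near. Qed.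

(** A constant horizon satisfies the assumption on kstar, so the risks at a
    fixed change point are a particular case of the uniform statement. *)
Lemma fixed_horizon_cvg (k : nat) :
  (`|ln alpha| + k%:R * ln (1 - rho alpha))%R
       @[alpha --> (0:R)%R^'+] --> +oo%R.
Proof.
apply/cvgryPge => A; near=> alpha.
have ln_q : (- ln (1 - rho alpha) <= 1)%R.
  by near: alpha; exact: near_ln_survival.
have : (A + k%:R <= `|ln alpha|)%R by near: alpha; exact: near_ln_large.
have : (k%:R * - ln (1 - rho alpha) <= k%:R * 1)%R by rewrite ler_wpM2l.
lra.
Unshelve. all: by end_near. Qed.

Lemma conditional_risk_asymp_lower nu (d : R) : (0 < d < 1)%R ->
  \forall alpha \near (0:R)%R^'+, forall tau, D alpha tau ->
    ((1 - d) * (`|ln alpha| / I))%:E <= conditional_risk P nu tau.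
Proof.
move=> d01; have half0 : (0 < 2^-1 :> R)%R by rewrite invr_gt0.
have half1 : (2^-1 < 1 :> R)%R by rewrite invf_lt1 // ltr1n.
near=> alpha => tau tauD.
have early : forall tau m, D alpha tau ->
    (m <= nu)%N -> Pinf [set w | tau w <= m%:R%:E] <= (2^-1)%:E.
  by near: alpha; exact: (near_early_stopping half0 (fixed_horizon_cvg nu)).
have /andP[risk_le _] :=
  conditional_risk_bounds tauD.1 half1 (early _ _ tauD (leqnn nu)).
apply: le_trans risk_le; move: tau tauD; near: alpha.
exact: risk_asymp_lower.
Unshelve. all: by end_near. Qed.

Lemma conditional_risk_asymp_upper (kstar : R -> nat) (d : R) : (0 < d < 1)%R ->
  (`|ln alpha| + (kstar alpha)%:R * ln (1 - rho alpha))%R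
       @[alpha --> (0:R)%R^'+] --> +oo%R ->
  \forall alpha \near (0:R)%R^'+, forall nu, (nu <= kstar alpha)%N ->
    conditional_risk P nu (T alpha) <= ((1 + d) * (`|ln alpha| / I))%:E.
Proof.
move=> /andP[d0 d1] kstar_cvg; pose x := (d / 4)%R.
have x0 : (0 < x)%R by rewrite divr_gt0.
have x1 : (x < 1)%R by rewrite /x; lra.
have d201 : (0 < d / 2 < 1)%R by apply/andP; split; lra.
have d_x : ((1 + d / 2) <= (1 + d) * (1 - x))%R by rewrite /x; nra.
near=> alpha => nu nu_k.
have TD : D alpha (T alpha) by near: alpha; exact: near_Delta_sr_time.
have early : forall tau nu, D alpha tau ->
    (nu <= kstar alpha)%N -> Pinf [set w | tau w <= nu%:R%:E] <= x%:E.
  by near: alpha; exact: near_early_stopping.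
have risk_le : forall nu,
    risk P nu (T alpha) <= ((1 + d / 2) * (`|ln alpha| / I))%:E.
  by near: alpha; exact: risk_asymp_upper.
have /andP[_ /le_trans] := conditional_risk_bounds TD.1 x1 (early _ _ TD nu_k).
apply; rewrite muleC lee_pdivrMl ?subr_gt0 //; apply: (le_trans (risk_le nu)).
rewrite -EFinM lee_fin [leRHS]mulrA [((1 - x) * _)%R]mulrC ler_wpM2r //.
by rewrite divr_ge0 // ltW.
Unshelve. all: by end_near. Qed.

(** Optimality for an arbitrary loss G: the infimum over [Delta] lies between
    the uniform lower bound and the loss of the Shiryaev-Roberts time, which
    belongs to [Delta] eventually. *)
Lemma asymp_optimal (G : R -> (Omega -> \bar R) -> \bar R) :
  (forall d : R, (0 < d < 1)%R ->
    \forall alpha \near (0:R)%R^'+, forall tau, D alpha tau ->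
      ((1 - d) * (`|ln alpha| / I))%:E <= G alpha tau) ->
  (forall d : R, (0 < d < 1)%R ->
    \forall alpha \near (0:R)%R^'+,
      G alpha (T alpha) <= ((1 + d) * (`|ln alpha| / I))%:E) ->
  (ereal_inf [set G alpha tau | tau in D alpha] / G alpha (T alpha)
     @[alpha --> (0:R)%R^'+] --> 1) /\
  asymp_equiv (fun alpha => G alpha (T alpha))
    (fun alpha => (`|ln alpha| / I)%R%:E).
Proof.
move=> lower upper; apply: asymp_squeeze.
- near=> alpha; rewrite divr_gt0 // (lt_le_trans ltr01) //.
  by near: alpha; exact: near_ln_large.
- near=> alpha; apply: ereal_inf_lbound; exists (T alpha) => //.
  by near: alpha; exact: near_Delta_sr_time.
- move=> d d01; near=> alpha; apply: le_ereal_inf_tmp => _ [tau tauD <-].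
  by move: tau tauD; near: alpha; exact: lower.
- exact: upper.
Unshelve. all: by end_near. Qed.

End model.

Theorem theorem3 (R : realType) (dO dE : measure_display)
  (Omega : measurableType dO) (E : measurableType dE)
  (mu : {sigma_finite_measure set E -> \bar R})
  (X : nat -> Omega -> E)
  (Pinf : probability Omega R) (P : nat -> probability Omega R)
  (f0 : forall n : nat, n.-1.-tuple E -> E -> R)
  (f1 : nat -> forall n : nat, n.-1.-tuple E -> E -> R)
  (model : change_point_model mu X Pinf P f0 f1)
  (rho : R -> R)
  (rho01 : forall alpha : R, (0 < alpha < 1)%R -> (0 < rho alpha < 1)%R)
  (I : R) (I_gt0 : (0 < I)%R)
  (hconv : uniform_complete_convergence X P f0 f1 I)
  (rho_cvg0 : rho alpha @[alpha --> (0:R)%R^'+] --> (0:R)%R)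
  (log_rho : (`|ln (rho alpha)| / `|ln alpha|)%R
               @[alpha --> (0:R)%R^'+] --> (0:R)%R) :
  let D (alpha : R) := Delta X Pinf alpha (rho alpha) in
  let T (alpha : R) := sr_time X f0 f1 (sr_threshold alpha (rho alpha)) in
  let rate (alpha : R) := (`|ln alpha| / I)%R%:E in
  let infR (nu : nat) (alpha : R) :=
    ereal_inf [set risk P nu tau | tau in D alpha] in
  let RT (nu : nat) (alpha : R) := risk P nu (T alpha) in
  let supR (tau : Omega -> \bar R) :=
    ereal_sup (range (fun nu : nat => risk P nu tau)) in
  let infsupR (alpha : R) := ereal_inf [set supR tau | tau in D alpha] in
  let supRT (alpha : R) := supR (T alpha) in
  let infR' (nu : nat) (alpha : R) :=
    ereal_inf [set conditional_risk P nu tau | tau in D alpha] in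
  let RT' (nu : nat) (alpha : R) := conditional_risk P nu (T alpha) in
  let maxR' (k : nat) (tau : Omega -> \bar R) :=
    \big[maxe/-oo]_(0 <= nu < k.+1) conditional_risk P nu tau in
  (* (i) *)
  [/\ (forall nu : nat,
         infR nu alpha / RT nu alpha @[alpha --> (0:R)%R^'+] --> 1),
      infsupR alpha / supRT alpha @[alpha --> (0:R)%R^'+] --> 1,
      (forall nu : nat,
         asymp_equiv (infR nu) (RT nu) /\ asymp_equiv (RT nu) rate) &
      asymp_equiv infsupR supRT /\ asymp_equiv supRT rate] /\
  (* (ii) *)
  (forall kstar : R -> nat,
     kstar alpha @[alpha --> (0:R)%R^'+] --> \oo ->
     (`|ln alpha| + (kstar alpha)%:R * ln (1 - rho alpha))%R
       @[alpha --> (0:R)%R^'+] --> +oo%R ->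
     let infmaxR' (alpha : R) :=
       ereal_inf [set maxR' (kstar alpha) tau | tau in D alpha] in
     let maxRT' (alpha : R) := maxR' (kstar alpha) (T alpha) in
     [/\ (forall nu : nat,
            infR' nu alpha / RT' nu alpha @[alpha --> (0:R)%R^'+] --> 1),
         infmaxR' alpha / maxRT' alpha @[alpha --> (0:R)%R^'+] --> 1,
         (forall nu : nat,
            asymp_equiv (infR' nu) (RT' nu) /\ asymp_equiv (RT' nu) rate) &
         asymp_equiv infmaxR' maxRT' /\ asymp_equiv maxRT' rate]).
Proof.
move=> D T rate infR RT supR infsupR supRT infR' RT' maxR'.
have optimal := asymp_optimal model rho01 I_gt0 log_rho.
have lower := risk_asymp_lower model rho01 I_gt0 hconv rho_cvg0.
have upper := risk_asymp_upper model rho01 I_gt0 hconv log_rho.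
have lower' := conditional_risk_asymp_lower model rho01 I_gt0 hconv rho_cvg0.
have upper' := conditional_risk_asymp_upper model rho01 I_gt0 hconv log_rho.
have risk_opt nu :
    (infR nu alpha / RT nu alpha @[alpha --> (0:R)%R^'+] --> 1) /\
    asymp_equiv (RT nu) rate.
  apply: (optimal (fun _ => risk P nu)) => d d01; first exact: lower.
  by near=> alpha; move: nu; near: alpha; exact: upper.
(* the lower bound at the change point 0 is already sharp for the supremum *)
have sup_opt : (infsupR alpha / supRT alpha @[alpha --> (0:R)%R^'+] --> 1) /\
    asymp_equiv supRT rate.
  apply: (optimal (fun _ => supR)) => d d01.
    near=> alpha => tau tauD; apply: (@le_trans _ _ (risk P 0 tau)).
      by move: tau tauD; near: alpha; exact: lower.
    by apply: ereal_sup_ubound; exists 0%N.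
  near=> alpha; apply: ge_ereal_sup => _ [nu _ <-]; move: nu; near: alpha.
  exact: upper.
split.
  by split=> [nu||nu|//];
    [exact: (risk_opt nu).1|exact: sup_opt.1|exact: risk_opt].
move=> kstar _ kstar_cvg infmaxR' maxRT'.
have cond_opt nu :
    (infR' nu alpha / RT' nu alpha @[alpha --> (0:R)%R^'+] --> 1) /\
    asymp_equiv (RT' nu) rate.
  apply: (optimal (fun _ => conditional_risk P nu)) => d d01.
    exact: lower'.
  have up := upper' (fun=> nu) d d01 (fixed_horizon_cvg rho01 rho_cvg0 nu).
  by near=> alpha; apply: (near up alpha).
have max_opt :
    (infmaxR' alpha / maxRT' alpha @[alpha --> (0:R)%R^'+] --> 1) /\
    asymp_equiv maxRT' rate.
  apply: (optimal (fun alpha => maxR' (kstar alpha))) => d d01.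
    near=> alpha => tau tauD; apply: (@le_trans _ _ (conditional_risk P 0 tau)).
      by move: tau tauD; near: alpha; exact: lower'.
    exact: (le_bigmax_seq -oo 0%N xpredT (fun nu => conditional_risk P nu tau)).
  near=> alpha; rewrite /maxR' big_nat; apply: bigmax_le; first exact: leNye.
  move=> nu /andP[_]; rewrite ltnS; move: nu; near: alpha.
  exact: upper'.
by split=> [nu||nu|//];
    [exact: (cond_opt nu).1|exact: max_opt.1|exact: cond_opt].
Unshelve. all: by end_near. Qed.
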